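(* Let $r\ge 2$, $d_1,\dots,d_r\in\mathbb{N}$, and let $X\subseteq\prod_{i\in[r]}\mathbb{R}^{d_i}$ be a semilinear set which does not contain a product $A_1\times\dots\times A_r$ with each $A_i\subseteq\mathbb{R}^{d_i}$ infinite. Then there is a constant $\alpha=\alpha(X)$ such that for all finite $V_i\subseteq\mathbb{R}^{d_i}$, $i\in[r]$, with $n=\sum_{i=1}^r|V_i|$, we have $|X\cap\prod_{i\in[r]}V_i|\leq\alpha n^{r-1}$.
   Context: A set $X\subseteq\mathbb{R}^d$ is semilinear if it is a finite union of sets of the form $\{x\in\mathbb{R}^d: f_1(x)\le 0,\dots,f_p(x)\le 0,f_{p+1}(x)<0,\dots,f_s(x)<0\}$, where each $f_i$ is an affine function $x\mapsto\lambda_1x_1+\dots+\lambda_dx_d+a$ with real coefficients. *)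

(* Defs.v *)
From HB Require Import structures.
From mathcomp Require Import all_boot all_order all_algebra finmap.
From mathcomp Require Import mathcomp_extra boolp classical_sets functions.
From mathcomp Require Import cardinality reals.

Set Implicit Arguments.
Unset Strict Implicit.
Unset Printing Implicit Defensive.

Import Order.TTheory GRing.Theory Num.Theory.
Local Open Scope classical_set_scope.
Local Open Scope ring_scope.

Section Semilinear.
Variables (R : realType) (d : nat).

(* (l, a) encodes the affine function x |-> l_1 x_1 + ... + l_d x_d + a. *)
Definition affine_form : Type := ('rV[R]_d * R)%type.

Definition affine_eval (f : affine_form) (x : 'rV[R]_d) : R :=
  (\sum_(j < d) f.1 0 j * x 0 j) + f.2.

Definition basic_semilinear (weak strict : seq affine_form) : set 'rV[R]_d :=
  [set x | (forall f, f \in weak -> affine_eval f x <= 0) /\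
           (forall f, f \in strict -> affine_eval f x < 0)].

Definition semilinear_set (X : set 'rV[R]_d) : Prop :=
  exists s : seq (seq affine_form * seq affine_form),
    X = [set x | exists b, b \in s /\ basic_semilinear b.1 b.2 x].

End Semilinear.

Section BlockProduct.
Variables (R : realType) (r : nat) (d : 'I_r -> nat).

(* The product of the spaces R^(d i) is R^(\sum_i d i): by mxrowK and
   submxrowK, x |-> (submxrow x i)_i is a bijection with inverse \mxrow. *)
Definition block_product (A : forall i, set 'rV[R]_(d i)) :
    set 'rV[R]_(\sum_(i < r) d i) :=
  [set x | forall i, A i (submxrow x i)].

(* fset_set is the empty set on infinite sets; this shows that the cardinals
   of subsets of block_product (fun i => [set` V i]) are the actual ones. *)
Lemma finite_block_product (V : forall i, {fset 'rV[R]_(d i)}) :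
  finite_set (block_product (fun i => [set` V i])).
Proof.
pose g (f : {dffun forall i, V i}) := \mxrow_i (val (f i)).
apply: (@sub_finite_set _ _ (g @` setT)); last first.
  exact/finite_image/finite_finset.
move=> x xV; exists [ffun i => [` xV i]%fset] => //.
by rewrite -[RHS]submxrowK; apply/eq_mxrow => i; rewrite ffunE.
Qed.

End BlockProduct.

(* Main.v *)
(** Each basic piece P of X is convex.  If for every i the piece P contains two
    distinct points p_i, q_i that differ only in block i, then the average of
    the segments [p_i, q_i] is a product of nondegenerate segments contained
    in P.  Hence for some i every point of P is determined by its blocks
    j <> i, so P meets the product of the V_j in at most n^(r-1) points, and
    alpha can be taken to be the number of pieces. *)

Require Import Defs.
From HB Require Import structures.
From mathcomp Require Import all_boot all_order all_algebra finmap.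
From mathcomp Require Import mathcomp_extra boolp classical_sets functions.
From mathcomp Require Import cardinality reals.

Set Implicit Arguments.
Unset Strict Implicit.
Unset Printing Implicit Defensive.

Import Order.TTheory GRing.Theory Num.Theory.
Local Open Scope classical_set_scope.
Local Open Scope ring_scope.

Lemma affine_eval_convex (R : realType) (d : nat) (I : finType)
    (f : affine_form R d) (c : I -> R) (w : I -> 'rV[R]_d) :
  \sum_i c i = 1 ->
  affine_eval f (\sum_i c i *: w i) = \sum_i c i * affine_eval f (w i).
Proof.
move=> c1; rewrite /affine_eval.
under [RHS]eq_bigr do rewrite mulrDr mulr_sumr.
rewrite big_split /= -mulr_suml c1 mul1r exchange_big /=; congr (_ + _).
apply: eq_bigr => j _; rewrite summxE mulr_sumr; apply: eq_bigr => i _.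
by rewrite mxE mulrCA.
Qed.

Lemma basic_semilinear_convex (R : realType) (d : nat) (I : finType)
    (weak strict : seq (affine_form R d)) (c : I -> R) (w : I -> 'rV[R]_d) :
  (forall i, 0 <= c i) -> \sum_i c i = 1 ->
  (forall i, basic_semilinear weak strict (w i)) ->
  basic_semilinear weak strict (\sum_i c i *: w i).
Proof.
move=> c0 c1 wP; split=> f ff; rewrite affine_eval_convex //.
  by apply: sumr_le0 => i _; apply: mulr_ge0_le0 => //; apply: (wP i).1.
(* For the strict inequalities one term must be strictly negative, so a positive weight is needed;
   nonnegative weights with sum 1 cannot all vanish. *)
have [[i ci]|c0'] := pselect (exists i, 0 < c i); last first.
  have: \sum_i c i = 0.
    apply: big1 => i _; apply/eqP; rewrite eq_le c0 andbT leNgt.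
    by apply/negP => ci; apply: c0'; exists i.
  by rewrite c1 => /eqP; rewrite oner_eq0.
rewrite (bigD1 i) //= -[ltRHS]addr0 ltr_leD ?pmulr_rlt0 ?(wP i).2 //.
apply: sumr_le0 => j _; apply: mulr_ge0_le0 => //.
exact/ltW/(wP j).2.
Qed.

Lemma infinite_range_nat (T : Type) (g : nat -> T) :
  injective g -> infinite_set (range g).
Proof.
move=> g_inj /(finite_preimage (in2W g_inj)).
by rewrite preimage_range; apply: infinite_nat.
Qed.

(* Averaging the segments [p i, q i], each parallel to block i, moves the
   blocks independently of one another. *)
Lemma convex_infinite_box (R : realType) (r : nat) (d : 'I_r -> nat)
    (P : set 'rV[R]_(\sum_(i < r) d i))
    (p q : 'I_r -> 'rV[R]_(\sum_(i < r) d i)) :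
  (0 < r)%N ->
  (forall (I : finType) (c : I -> R) w, (forall i, 0 <= c i) ->
     \sum_i c i = 1 -> (forall i, P (w i)) -> P (\sum_i c i *: w i)) ->
  (forall i, [/\ P (p i), P (q i), p i != q i &
     forall j, j != i -> submxrow (p i) j = submxrow (q i) j]) ->
  exists A : forall i, set 'rV[R]_(d i),
    (forall i, infinite_set (A i)) /\ block_product A `<=` P.
Proof.
move=> r0 P_convex pq.
have rN0 : r%:R != 0 :> R by rewrite pnatr_eq0 -lt0n.
(* Any injective sequence in [[0, 1]] would do: it supplies infinitely many points on each
   segment. *)
pose t (k : nat) : R := k.+1%:R^-1.
have t0 k : 0 <= t k by rewrite invr_ge0.
have t1 k : t k <= 1 by rewrite invf_le1 ?ler1n.
pose z (s : 'I_r -> R) : 'rV[R]_(\sum_(i < r) d i) :=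
  \sum_i r%:R^-1 *: ((1 - s i) *: p i + s i *: q i).
(* Block [i] of [z s] depends on [s i] alone, as [z_block] shows, so the constant family loses
   nothing. *)
pose g i k : 'rV[R]_(d i) := submxrow (z (fun=> t k)) i.
have z_block s i : submxrow (z s) i =
    submxrow (\sum_j r%:R^-1 *: p j) i
      + (r%:R^-1 * s i) *: submxrow (q i - p i) i.
  have -> : z s = \sum_j r%:R^-1 *: p j
      + \sum_j (r%:R^-1 * s j) *: (q j - p j).
    rewrite -big_split; apply: eq_bigr => j _ /=.
    rewrite -scalerA -scalerDr; congr (_ *: _).
    by rewrite scalerBl scale1r scalerBr addrA addrAC.
  apply/rowP => k; rewrite !mxE; congr (_ + _).
  rewrite summxE (bigD1 i) //= [X in _ + X]big1 ?addr0 ?mxE // => j ji.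
  have [_ _ _ /(_ i)] := pq j; rewrite eq_sym => /(_ ji) /rowP /(_ k).
  by rewrite !mxE => ->; rewrite subrr mulr0.
exists (fun i => range (g i)); split=> [i|x xA].
  apply: infinite_range_nat => k l; rewrite /g !z_block => /addrI /eqP.
  rewrite -subr_eq0 -scalerBl scaler_eq0 -mulrBr mulf_eq0 invr_eq0.
  rewrite (negPf rN0) /= subr_eq0 => /orP[/eqP/invr_inj/eqP|/eqP qp0].
    by rewrite eqr_nat eqSS => /eqP.
  (* If block [i] of [q i - p i] vanished, [p i] and [q i] would agree in every block. *)
  have [_ _ /eqP pNq pqi] := pq i; case: pNq.
  apply/mxrowP => j.
  have [->|/pqi //] := eqVneq j i.
  apply/rowP => m; move/rowP: qp0 => /(_ m); rewrite !mxE => /eqP.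
  by rewrite subr_eq0 => /eqP.
have [k xk] := choice (fun i => let: ex_intro2 k _ e := xA i in ex_intro _ k e).
(* The blocks of [x] may come from different parameters [k i]; independence of the blocks lets a
   single [z s] realize them all. *)
have -> : x = z (fun i => t (k i)).
  apply/mxrowP => i.
  by rewrite -xk /g !z_block.
(* Convexity is used twice: for the average with weights [1/r], then, with index type [bool], for
   each point on a segment. *)
apply: (P_convex _ (fun=> r%:R^-1)) => [i||i].
- by rewrite invr_ge0.
- by rewrite sumr_const card_ord -[LHS]mulr_natr mulVf.
have [Pp Pq _ _] := pq i.
have := P_convex _ (fun b : bool => if b then 1 - t (k i) else t (k i))
  (fun b => if b then p i else q i).
rewrite !big_bool /=; apply.
- by case; rewrite ?subr_ge0.
- by rewrite subrK.
- by case.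
Qed.

(** A point is recovered from a piece containing it and its [r.-1] blocks other than the determined
    one, each block being one of [n] elements of the disjoint union of the [V j]. *)
Lemma card_block_determined (R : realType) (r : nat) (d : 'I_r -> nat)
    (m : nat) (P : 'I_m -> set 'rV[R]_(\sum_(i < r) d i)) (i : 'I_m -> 'I_r)
    (V : forall i, {fset 'rV[R]_(d i)}) :
  (forall k x y, P k x -> P k y ->
     (forall j, j != i k -> submxrow x j = submxrow y j) -> x = y) ->
  (#|` fset_set ([set x | exists k, P k x] `&`
                 block_product (fun i => [set` V i]))|
     <= m * (\sum_(i < r) #|` V i|) ^ r.-1)%N.
Proof.
move=> P_det; set S := fset_set _.
have SP (x : S) : exists k, P k (val x).
  have := valP x; rewrite in_fset_set ?inE; first by case.
  by apply: finite_setIr; apply: finite_block_product.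
have SV (x : S) j : submxrow (val x) j \in V j.
  have := valP x; rewrite in_fset_set ?inE; first by case=> _; apply.
  by apply: finite_setIr; apply: finite_block_product.
have [k Pk] := choice SP.
pose T := {j : 'I_r & V j}.
(* [lift (i (k x))] enumerates the indices other than [i (k x)]. Values in the sum type [T] keep the
   codomain independent of the omitted block. *)
pose g (x : S) : 'I_m * {ffun 'I_r.-1 -> T} :=
  (k x, [ffun l => Tagged (fun j => V j) [` SV x (lift (i (k x)) l)]%fset]).
have g_inj : injective g.
  move=> x y [kxy /ffunP gxy]; apply/val_inj/(P_det (k x)) => //.
    by rewrite kxy.
  move=> j; case: (unliftP (i (k x)) j) => [l -> _|-> /eqP//].
  have := gxy l; rewrite !ffunE -kxy => /eqP; rewrite eq_Tagged /=.
  by move=> /eqP/(congr1 val).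
rewrite cardfE (leq_trans (leq_card _ g_inj)) //.
rewrite card_prod card_ffun !card_ord card_tagged sumnE big_map big_enum /=.
by under eq_bigr do rewrite -cardfE.
Qed.

Theorem mainTheorem4 (R : realType) (r : nat) (hr : (2 <= r)%N)
    (d : 'I_r -> nat) (X : set 'rV[R]_(\sum_(i < r) d i))
    (hX : semilinear_set X)
    (hprod : ~ exists A : forall i : 'I_r, set 'rV[R]_(d i),
        (forall i, infinite_set (A i)) /\ block_product A `<=` X) :
  exists alpha : R,
    forall V : forall i : 'I_r, {fset 'rV[R]_(d i)},
      let n : nat := (\sum_(i < r) #|` V i|)%N in
      (#|` fset_set (X `&` block_product (fun i => [set` V i]))|)%:R
        <= alpha * n%:R ^+ (r - 1).
Proof.
case: hX hprod => s -> noprod.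
(* The default of [nth] is never reached, as [k < size s]. *)
pose P (k : 'I_(size s)) := let b := nth ([::], [::]) s k in
  basic_semilinear b.1 b.2.
have XE : [set x | exists b, b \in s /\ basic_semilinear b.1 b.2 x]
    = [set x | exists k, P k x].
  apply/seteqP; split=> x /=.
    move=> [b [bs bx]]; have lt_bs : (index b s < size s)%N by rewrite index_mem.
    by exists (Ordinal lt_bs); rewrite /P /= nth_index.
  by move=> [k Pkx]; exists (nth ([::], [::]) s k); rewrite mem_nth.
rewrite XE in noprod *.
have P_det k : exists i : 'I_r, forall x y, P k x -> P k y ->
    (forall j, j != i -> submxrow x j = submxrow y j) -> x = y.
  (* If no block is determined by the others, each [i] yields a pair of points of [P k] differing
     only in block [i], and the resulting infinite box lies in [X]. *)
  apply: contrapT => /forallNP nodet; apply: noprod.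
  have pq i : exists z, [/\ P k z.1, P k z.2, z.1 != z.2 &
      forall j, j != i -> submxrow z.1 j = submxrow z.2 j].
    apply: contrapT => /forallNP noz; apply: (nodet i) => x y Px Py xy.
    by apply: contrapT => /eqP xNy; apply: (noz (x, y)).
  have [z zP] := choice pq.
  have [|I c w||A [Ainf AP]] := @convex_infinite_box R r d (P k)
    (fun i => (z i).1) (fun i => (z i).2).
  - exact: leq_trans hr.
  - exact: basic_semilinear_convex.
  - exact: zP.
  by exists A; split=> // x /AP Px; exists k.
have [i iP] := choice P_det.
exists (size s)%:R => V /=.
rewrite -natrX -natrM ler_nat subn1.
exact: card_block_determined iP.
Qed.
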